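(* Let $\mathbf{i}$ be the imaginary unit and let $S_{16}$ be the $16\times 16$ matrix with entries $[S_{16}]_{j,l}=\exp(2\pi \mathbf{i}\,E_{j,l}/8)$, where $$E=\left[\begin{array}{cccccccccccccccc} 0 & 0 & 0 & 0 & 0 & 0 & 0 & 0 & 0 & 0 & 0 & 0 & 0 & 0 & 0 & 0 \\ 0 & 4 & 1 & 5 & 2 & 6 & 3 & 7 & 0 & 4 & 1 & 5 & 2 & 6 & 3 & 7 \\ 0 & 4 & 3 & 7 & 6 & 2 & 1 & 5 & 0 & 4 & 3 & 7 & 6 & 2 & 1 & 5 \\ 0 & 0 & 4 & 4 & 0 & 0 & 4 & 4 & 0 & 0 & 4 & 4 & 0 & 0 & 4 & 4 \\ 0 & 4 & 5 & 1 & 2 & 6 & 7 & 3 & 0 & 4 & 5 & 1 & 2 & 6 & 7 & 3 \\ 0 & 0 & 6 & 6 & 4 & 4 & 2 & 2 & 0 & 0 & 6 & 6 & 4 & 4 & 2 & 2 \\ 0 & 4 & 7 & 3 & 6 & 2 & 5 & 1 & 0 & 4 & 7 & 3 & 6 & 2 & 5 & 1 \\ 0 & 0 & 2 & 2 & 4 & 4 & 6 & 6 & 2 & 2 & 4 & 4 & 6 & 6 & 0 & 0 \\ 0 & 1 & 0 & 1 & 0 & 1 & 0 & 1 & 4 & 5 & 4 & 5 & 4 & 5 & 4 & 5 \\ 0 & 5 & 0 & 5 & 0 & 5 & 0 & 5 & 4 & 1 & 4 & 1 & 4 & 1 & 4 & 1 \\ 0 & 4 & 2 & 6 & 4 & 0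 & 6 & 2 & 4 & 0 & 6 & 2 & 0 & 4 & 2 & 6 \\ 0 & 0 & 4 & 4 & 0 & 0 & 4 & 4 & 4 & 4 & 0 & 0 & 4 & 4 & 0 & 0 \\ 0 & 4 & 4 & 0 & 0 & 4 & 4 & 0 & 4 & 0 & 0 & 4 & 4 & 0 & 0 & 4 \\ 0 & 0 & 6 & 6 & 4 & 4 & 2 & 2 & 4 & 4 & 2 & 2 & 0 & 0 & 6 & 6 \\ 0 & 4 & 6 & 2 & 4 & 0 & 2 & 6 & 4 & 0 & 2 & 6 & 0 & 4 & 6 & 2 \\ 0 & 0 & 2 & 2 & 4 & 4 & 6 & 6 & 6 & 6 & 0 & 0 & 2 & 2 & 4 & 4 \end{array}\right].$$ For eleven real parameters $a,b,c,d,e,f,g,h,i,j,k$ (here $e$ and $i$ are real parameters, not constants) let $R=R(a,b,c,d,e,f,g,h,i,j,k)$ be $$R=\left[\begin{array}{cccccccccccccccc} 0&0&0&0&0&0&0&0&0&0&0&0&0&0&0&0 \\ 0&0& b & b & d & d & b+j & b+j &0&0& b & b & d & d & b+j & b+j \\ 0&0& c & c & d & d & c+j & c+j &0&0& c & c & d & d & c+j & c+j \\ 0&0&0&0&0&0&0&0&0&0&0&0&0&0&0&0 \\ 0&0& b & b & d & d & b+j & b+j &0&0& b & b & d & d & b+j & b+j \\ 0& h & h+i & i &0& h & h+i & i & h &0& i & h+i & h &0& i & h+i \\ 0&0& c & c & d & d & c+j & c+j &0&0& c & c & d & d & c+j & c+j \\ 0&0& i & i &0&0& i & i & g & g & g+i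 & g+i & g & g & g+i & g+i \\ 0& a & k & a &0& a & k & a &0& a & k & a &0& a & k & a \\ 0& a & k & a &0& a & k & a &0& a & k & a &0& a & k & a \\ 0& h & h+i & i &0& h & h+i & i & h &0& i & h+i & h &0& i & h+i \\ 0& f & k & f &0& f & k & f &0& f & k & f &0& f & k & f \\ 0& f & k & f &0& f & k & f &0& f & k & f &0& f & k & f \\ 0& e & i & e+i &0& e & i & e+i &0& e & i & e+i &0& e & i & e+i \\ 0& e & i & e+i &0& e & i & e+i &0& e & i & e+i &0& e & i & e+i \\ 0&0& i & i &0&0& i & i & g & g & g+i & g+i & g & g & g+i & g+i \end{array}\right].$$ Let $S_{16}^{(11)}(a,b,c,d,e,f,g,h,i,j,k)$ be the $16\times 16$ matrix whose $(s,t)$ entry is $[S_{16}]_{s,t}\cdot\exp(\mathbf{i}R_{s,t})$. Then $S_{16}^{(11)}(a,b,c,d,e,f,g,h,i,j,k)$ is a complex Hadamard matrix for all real values of the eleven parameters, and there is a neighbourhood $U$ of $S_{16}$ in $\mathbb{C}^{16\times 16}$ such that every member of this family lying in $U$ is not Dita-type.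
   Context: A complex Hadamard matrix of order $r$ is an $r\times r$ complex matrix all of whose entries have absolute value $1$ and whose rows are pairwise orthogonal with respect to the standard Hermitian inner product. Two complex Hadamard matrices $K_1,K_2$ are equivalent if $K_1=D_1P_1K_2P_2D_2$ for some unitary diagonal matrices $D_1,D_2$ and permutation matrices $P_1,P_2$. A complex Hadamard matrix of order $N$ is called Dita-type if, for some integers $k,n\ge 2$ with $kn=N$, it is equivalent to a block matrix $$K=\begin{bmatrix} m_{11}N_1&\cdots&m_{1k}N_k\\ \vdots&&\vdots\\ m_{k1}N_1&\cdots&m_{kk}N_k\end{bmatrix},$$ where $M=(m_{ij})$ is some $k\times k$ complex Hadamard matrix and $N_1,\dots,N_k$ are some $n\times n$ complex Hadamard matrices (possibly different from each other). *)

(* Defs.v *)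
From mathcomp Require Import all_boot all_order all_algebra.
From mathcomp Require Import complex.
From mathcomp Require Import all_classical all_reals all_analysis.

Set Implicit Arguments.
Unset Strict Implicit.
Unset Printing Implicit Defensive.

Import Order.TTheory GRing.Theory Num.Theory.
Import numFieldNormedType.Exports.

Local Open Scope classical_set_scope.
Local Open Scope complex_scope.
Local Open Scope ring_scope.

(* [dotmx] is the standard Hermitian inner product of row vectors,
   dotmx u v = (u *m v^t* ) 0 0. *)
Definition complex_hadamard (C : numClosedFieldType) (r : nat) (K : 'M[C]_r) :
    Prop :=
  (forall s t, `|K s t| = 1) /\
  (forall s s', s != s' -> dotmx (row s K) (row s' K) = 0).

Definition hadamard_equiv (C : numClosedFieldType) (r : nat)
    (K1 K2 : 'M[C]_r) : Prop :=
  exists D1 P1 P2 D2 : 'M[C]_r,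
    [/\ is_diag_mx D1 /\ D1 \is unitarymx,
        is_diag_mx D2 /\ D2 \is unitarymx,
        is_perm_mx P1, is_perm_mx P2
      & K1 = D1 *m P1 *m K2 *m P2 *m D2].

Lemma block_order (k n N : nat) : (k * n = N)%N -> (\sum_(i < k) n = N)%N.
Proof. by move=> <-; rewrite sum_nat_const card_ord. Qed.

(* The (i, j) block is M i j *: B j. The cast only identifies the order
   n + ... + n (k terms) of the block matrix with N. *)
Definition dita_block (C : numClosedFieldType) (k n N : nat)
    (kn : (k * n = N)%N) (M : 'M[C]_k) (B : 'I_k -> 'M[C]_n) : 'M[C]_N :=
  castmx (block_order kn, block_order kn)
    (\mxblock_(i < k, j < k) (M i j *: B j)).

(* K is not separately required to be Hadamard: this follows from the
   equivalence, since [dita_block kn M B] is Hadamard. *)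
Definition dita_type (C : numClosedFieldType) (N : nat) (K : 'M[C]_N) : Prop :=
  exists (k n : nat) (kn : (k * n = N)%N) (M : 'M[C]_k) (B : 'I_k -> 'M[C]_n),
    [/\ (2 <= k)%N, (2 <= n)%N, complex_hadamard M,
        (forall j, complex_hadamard (B j))
      & hadamard_equiv K (dita_block kn M B)].

Definition cexp (R : realType) (z : R[i]) : R[i] :=
  (expR (complex.Re z))%:C * (cos (complex.Im z) +i* sin (complex.Im z)).

Definition mx16_of_rows (T : Type) (x0 : T) (rows : seq (seq T)) : 'M[T]_16 :=
  \matrix_(s < 16, t < 16) nth x0 (nth [::] rows s) t.

Definition E16 : 'M[nat]_16 := mx16_of_rows 0%N (
  [::[:: 0; 0; 0; 0; 0; 0; 0; 0; 0; 0; 0; 0; 0; 0; 0; 0];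
   [:: 0; 4; 1; 5; 2; 6; 3; 7; 0; 4; 1; 5; 2; 6; 3; 7];
   [:: 0; 4; 3; 7; 6; 2; 1; 5; 0; 4; 3; 7; 6; 2; 1; 5];
   [:: 0; 0; 4; 4; 0; 0; 4; 4; 0; 0; 4; 4; 0; 0; 4; 4];
   [:: 0; 4; 5; 1; 2; 6; 7; 3; 0; 4; 5; 1; 2; 6; 7; 3];
   [:: 0; 0; 6; 6; 4; 4; 2; 2; 0; 0; 6; 6; 4; 4; 2; 2];
   [:: 0; 4; 7; 3; 6; 2; 5; 1; 0; 4; 7; 3; 6; 2; 5; 1];
   [:: 0; 0; 2; 2; 4; 4; 6; 6; 2; 2; 4; 4; 6; 6; 0; 0];
   [:: 0; 1; 0; 1; 0; 1; 0; 1; 4; 5; 4; 5; 4; 5; 4; 5];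
   [:: 0; 5; 0; 5; 0; 5; 0; 5; 4; 1; 4; 1; 4; 1; 4; 1];
   [:: 0; 4; 2; 6; 4; 0; 6; 2; 4; 0; 6; 2; 0; 4; 2; 6];
   [:: 0; 0; 4; 4; 0; 0; 4; 4; 4; 4; 0; 0; 4; 4; 0; 0];
   [:: 0; 4; 4; 0; 0; 4; 4; 0; 4; 0; 0; 4; 4; 0; 0; 4];
   [:: 0; 0; 6; 6; 4; 4; 2; 2; 4; 4; 2; 2; 0; 0; 6; 6];
   [:: 0; 4; 6; 2; 4; 0; 2; 6; 4; 0; 2; 6; 0; 4; 6; 2];
   [:: 0; 0; 2; 2; 4; 4; 6; 6; 6; 6; 0; 0; 2; 2; 4; 4]]%N).

Definition S16 (R : realType) : 'M[R[i]]_16 :=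
  \matrix_(s < 16, t < 16)
    cexp (2 * (pi : R)%:C * 'i%C * (E16 s t)%:R / 8).

Definition R16 (R : realType) (a b c d e f g h i j k : R) : 'M[R]_16 :=
  mx16_of_rows 0 (
  [::[:: 0; 0; 0; 0; 0; 0; 0; 0; 0; 0; 0; 0; 0; 0; 0; 0];
   [:: 0; 0; b; b; d; d; b + j; b + j; 0; 0; b; b; d; d; b + j; b + j];
   [:: 0; 0; c; c; d; d; c + j; c + j; 0; 0; c; c; d; d; c + j; c + j];
   [:: 0; 0; 0; 0; 0; 0; 0; 0; 0; 0; 0; 0; 0; 0; 0; 0];
   [:: 0; 0; b; b; d; d; b + j; b + j; 0; 0; b; b; d; d; b + j; b + j];
   [:: 0; h; h + i; i; 0; h; h + i; i; h; 0; i; h + i; h; 0; i; h + i];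
   [:: 0; 0; c; c; d; d; c + j; c + j; 0; 0; c; c; d; d; c + j; c + j];
   [:: 0; 0; i; i; 0; 0; i; i; g; g; g + i; g + i; g; g; g + i; g + i];
   [:: 0; a; k; a; 0; a; k; a; 0; a; k; a; 0; a; k; a];
   [:: 0; a; k; a; 0; a; k; a; 0; a; k; a; 0; a; k; a];
   [:: 0; h; h + i; i; 0; h; h + i; i; h; 0; i; h + i; h; 0; i; h + i];
   [:: 0; f; k; f; 0; f; k; f; 0; f; k; f; 0; f; k; f];
   [:: 0; f; k; f; 0; f; k; f; 0; f; k; f; 0; f; k; f];
   [:: 0; e; i; e + i; 0; e; i; e + i; 0; e; i; e + i; 0; e; i; e + i];
   [:: 0; e; i; e + i; 0; e; i; e + i; 0; e; i; e + i; 0; e; i; e + i];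
   [:: 0; 0; i; i; 0; 0; i; i; g; g; g + i; g + i; g; g; g + i; g + i]]).

Definition S16_11 (R : realType) (a b c d e f g h i j k : R) : 'M[R[i]]_16 :=
  \matrix_(s < 16, t < 16)
    (S16 R s t * cexp ('i%C * (R16 a b c d e f g h i j k s t)%:C)).

(* Main.v *)
(* Each entry of the family is omega^E exp(i L) with omega a primitive eighth
   root of unity and L an integral linear form in the parameters. For every
   pair of distinct rows the 16 summands of the Hermitian product are permuted
   by x |-> -x as formal monomials (omega^(m+4) = - omega^m), so they cancel.

   In a Dita-type matrix with blocks of order n = N/k, the rows split into n
   classes of size k and the columns into k classes of size n such that
   K s t * K s' t' = K s t' * K s' t for s, s' in one row class and t, t' in
   one column class. The first column of the family is constant, so in each
   column t of the class of the first one the level sets have size divisible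
   by k. Near S16, entries that differ in a column of S16 stay different, so
   the level sets of column t of E are unions of row classes as well. As k is a
   power of 2 and every column but 0 and 4 has an odd level size, the class is
   {0, 4}, so n = 2 and k = 8; but column 4 has a level of size 2. *)

Require Import Defs.
From mathcomp Require Import all_boot all_order all_algebra.
From mathcomp Require Import fingroup perm complex ring.
From mathcomp Require Import all_classical all_reals all_analysis.

Import Order.TTheory GRing.Theory Num.Theory.
Import numFieldNormedType.Exports.

Local Open Scope complex_scope.
Local Open Scope ring_scope.

(** * Entries of Dita-type matrices and counting in fibres *)

Lemma mxblock_const_index (k n : nat) :
  exists2 f : 'I_(\sum_(i < k) n) -> 'I_k * 'I_n, injective f &
    forall (T : Type) (B : 'I_k -> 'I_k -> 'M[T]_n) x y,
      (\mxblock_(i < k, j < k) B i j) x y =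
        B (f x).1 (f y).1 (f x).2 (f y).2.
Proof.
exists (fun x => (tagnat.sig1 x, tagnat.sig2 x)) => [x y [e1 e2]|T B x y].
  apply: val_inj; rewrite [LHS](tagnat.rect x) [RHS](tagnat.rect y) e1.
  congr addn; exact: (congr1 (@nat_of_ord n) e2).
by rewrite mxE.
Qed.

(** The permutations are absorbed into the indexings [f], [g] and the diagonal matrices into [d],
    [e]. Once [(f x).2] and [(g y).1] are fixed, the entry is a function of [x] times a function of
    [y]; these two coordinates define the row and column classes. *)
Lemma dita_typeE (C : numClosedFieldType) (N : nat) (K : 'M[C]_N) :
  dita_type K -> exists (k n : nat) (f g : 'I_N -> 'I_k * 'I_n)
    (M : 'M[C]_k) (B : 'I_k -> 'M[C]_n) (d e : 'I_N -> C),
    [/\ (k * n = N)%N, (2 <= k)%N /\ (2 <= n)%N, injective f, injective g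
      & forall x y, K x y =
          d x * (M (f x).1 (g y).1 * B (g y).1 (f x).2 (g y).2) * e y].
Proof.
move=> [k [n [kn [M [B [k2 n2 _ _]]]]]].
move=> [D1 [P1 [P2 [D2 [[/diag_mxP[d ->] _] [/diag_mxP[e ->] _]]]]]].
move=> /is_perm_mxP[p ->] /is_perm_mxP[q ->] KE.
have [f f_inj fE] := mxblock_const_index k n.
pose c := cast_ord (esym (block_order kn)).
have c_inj : injective c by exact: cast_ord_inj.
(* A permutation matrix on the right permutes columns by the inverse permutation. *)
exists k, n, (fun x => f (c (p x))), (fun x => f (c ((q^-1)%g x))), M, B.
exists (d 0), (e 0).
split => //.
- by move=> x y /f_inj/c_inj; exact: perm_inj.
- by move=> x y /f_inj/c_inj; exact: perm_inj.
move=> x y; rewrite KE -!mulmxA mul_diag_mx mxE !mulmxA mul_mx_diag mxE mulrA.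
by rewrite -row_permE -[q]invgK -col_permE !mxE invgK castmxE fE mxE.
Qed.

Lemma card_fiber_snd (N k n : nat) (f : 'I_N -> 'I_k * 'I_n) (s : 'I_n) :
  (k * n = N)%N -> injective f -> #|[set x | (f x).2 == s]| = k.
Proof.
move=> kn f_inj.
have f_bij : bijective f.
  by apply: inj_card_bij => //; rewrite card_prod !card_ord kn.
transitivity #|f @^-1: finset.setX [set: 'I_k] [set s]|.
  by apply: eq_card => x; rewrite !inE.
rewrite on_card_preimset; last exact: onW_bij.
by rewrite cardsX cardsT card_ord cards1 muln1.
Qed.

Lemma card_fiber_fst (N k n : nat) (f : 'I_N -> 'I_k * 'I_n) (j : 'I_k) :
  (k * n = N)%N -> injective f -> #|[set x | (f x).1 == j]| = n.
Proof.
move=> kn f_inj; pose h x := ((f x).2, (f x).1).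
have h_inj : injective h.
  move=> x y [e2 e1]; apply: f_inj.
  by rewrite [f x]surjective_pairing e1 e2 -surjective_pairing.
exact: (card_fiber_snd _ _ _ h j (etrans (mulnC n k) kn) h_inj).
Qed.

(** [A] is a disjoint union of fibres of [r]. *)
Lemma dvdn_card_saturated (T I : finType) (r : T -> I) (k : nat) (A : {set T}) :
  (forall i, #|[set x | r x == i]| = k) ->
  (forall x y, r x = r y -> x \in A -> y \in A) -> (k %| #|A|)%N.
Proof.
move=> rk satA; rewrite -sum1_card (partition_big r predT) //=.
apply: dvdn_sum => i _; rewrite sum1_card.
have [x /andP[xA /eqP rx]|A0] := pickP [pred x | (x \in A) && (r x == i)].
  rewrite -(rk i); 
  have -> : #|[pred x | (x \in A) && (r x == i)]| = #|[set x | r x == i]|.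
    apply: eq_card => y; rewrite !inE andb_idl // => /eqP ry.
    by apply: satA xA; rewrite rx ry.
  by rewrite rk.
by rewrite (eq_card0 A0) dvdn0.
Qed.

(** * The unit circle and the eighth roots of unity *)

Section UnitCircle.
Variable R : realType.
Implicit Types x y : R.

Definition expi x : R[i] := cos x +i* sin x.

Lemma expi0 : expi 0 = 1.
Proof. by rewrite /expi cos0 sin0. Qed.

Lemma expiD x y : expi (x + y) = expi x * expi y.
Proof.
apply/eqP.
by rewrite eq_complex /= cosD sinD addrC (addrC (sin x * _)) !eqxx.
Qed.

Lemma expi_pi : expi pi = -1.
Proof. by apply/eqP; rewrite eq_complex /= cospi sinpi oppr0 !eqxx. Qed.

Lemma norm_expi x : `|expi x| = 1.
Proof. by rewrite normc_def /= cos2Dsin2 sqrtr1. Qed.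

Lemma expi_neq0 x : expi x != 0.
Proof. by rewrite -normr_eq0 norm_expi oner_neq0. Qed.

Lemma expiN x : expi (- x) = (expi x)^-1.
Proof.
apply: (mulIf (expi_neq0 x)).
by rewrite -expiD addNr expi0 mulVf ?expi_neq0.
Qed.

Lemma expiMn x m : expi (x *+ m) = expi x ^+ m.
Proof. by elim: m => [|m IH]; rewrite ?expi0 // mulrS exprS expiD IH. Qed.

Lemma conj_norm1 (z : R[i]) : `|z| = 1 -> z^*%R = z^-1.
Proof. by move=> z1; rewrite invC_norm z1 expr1n invr1 mul1r. Qed.

Lemma cexp_imaginary x : cexp ('i%C * x%:C) = expi x.
Proof. by rewrite /cexp /= !mul0r !mul1r subrr expR0 !add0r mul1r. Qed.

Definition omega : R[i] := expi (pi / 4).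

Lemma omega4 : omega ^+ 4 = -1.
Proof. by rewrite -expiMn -[_ *+ 4]mulr_natr divfK ?pnatr_eq0 // expi_pi. Qed.

(** The order divides 8 but not 4, since [omega ^+ 4] is -1. *)
Lemma omega_prim : 8.-primitive_root omega.
Proof.
have o8 : omega ^+ 8 = 1 by rewrite (exprM omega 4 2) omega4 sqrrN expr1n.
have [m m_prim m8] := prim_order_exists (n := 8) isT o8.
have : ~~ (m %| 4)%N.
  rewrite (prim_order_dvd m_prim) omega4 eq_sym -subr_eq0 opprK.
  by rewrite -[1 + 1]/(2%:R) pnatr_eq0.
have : (m <= 8)%N by exact: dvdn_leq.
by move: m m_prim m8; do 9?[case=> //].
Qed.

(** On the unit circle conjugation is inversion, and 7 represents -1 modulo 8, which keeps exponents
    natural. *)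
Lemma conj_omegaX m : (omega ^+ m)^*%R = omega ^+ (7 * m).
Proof.
rewrite conj_norm1; last by rewrite normrX norm_expi expr1n.
have om : omega ^+ m != 0 by rewrite expf_neq0 // expi_neq0.
apply: (mulIf om); rewrite mulVf // -exprD -mulSnr mulnC exprM.
by rewrite exprAC (prim_expr_order omega_prim) expr1n.
Qed.

Lemma omega_antipode m : omega ^+ ((m + 4) %% 8) = - omega ^+ (m %% 8).
Proof. by rewrite !(prim_expr_mod omega_prim) exprD omega4 mulrN1. Qed.

Lemma cexp_eighth m :
  cexp (2 * (pi : R)%:C * 'i%C * m%:R / 8) = omega ^+ m.
Proof.
rewrite -expiMn -cexp_imaginary; congr cexp.
have -> : (pi / 4 *+ m)%:C = pi%:C / 4 * m%:R :> R[i].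
  rewrite -[_ *+ m]mulr_natr !(rmorphM (real_complex R)).
  by rewrite (fmorphV (real_complex R)) !(rmorph_nat (real_complex R)).
by field.
Qed.

End UnitCircle.

(** * Symbolic entries and symbolic row products *)

Definition exponent_rows : seq (seq nat) :=
  ltac:(match eval unfold E16 in E16 with
        | mx16_of_rows _ ?rows => exact rows end).

(** Reading from plain lists lets [vm_compute] decide statements about all rows and columns. *)
Definition exponent (s t : nat) : nat := nth 0%N (nth [::] exponent_rows s) t.

Lemma E16E s t : E16 s t = exponent s t.
Proof. by rewrite mxE. Qed.

(* The parameter table of [R16] over an arbitrary addition, so that it can be
   evaluated on integer vectors as well as on reals. *)
Definition phase_rows (T : Type) (o : T) (add : T -> T -> T)
    (a b c d e f g h i j k : T) : seq (seq T) :=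
  let bj := add b j in let cj := add c j in let hi := add h i in
  let gi := add g i in let ei := add e i in
  [::[:: o; o; o; o; o; o; o; o; o; o; o; o; o; o; o; o];
   [:: o; o; b; b; d; d; bj; bj; o; o; b; b; d; d; bj; bj];
   [:: o; o; c; c; d; d; cj; cj; o; o; c; c; d; d; cj; cj];
   [:: o; o; o; o; o; o; o; o; o; o; o; o; o; o; o; o];
   [:: o; o; b; b; d; d; bj; bj; o; o; b; b; d; d; bj; bj];
   [:: o; h; hi; i; o; h; hi; i; h; o; i; hi; h; o; i; hi];
   [:: o; o; c; c; d; d; cj; cj; o; o; c; c; d; d; cj; cj];
   [:: o; o; i; i; o; o; i; i; g; g; gi; gi; g; g; gi; gi];
   [:: o; a; k; a; o; a; k; a; o; a; k; a; o; a; k; a];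
   [:: o; a; k; a; o; a; k; a; o; a; k; a; o; a; k; a];
   [:: o; h; hi; i; o; h; hi; i; h; o; i; hi; h; o; i; hi];
   [:: o; f; k; f; o; f; k; f; o; f; k; f; o; f; k; f];
   [:: o; f; k; f; o; f; k; f; o; f; k; f; o; f; k; f];
   [:: o; e; i; ei; o; e; i; ei; o; e; i; ei; o; e; i; ei];
   [:: o; e; i; ei; o; e; i; ei; o; e; i; ei; o; e; i; ei];
   [:: o; o; i; i; o; o; i; i; g; g; gi; gi; g; g; gi; gi]].

Lemma map_phase_rows (T U : Type) (F : T -> U) o add o' add'
    (a b c d e f g h i j k : T) :
  F o = o' -> {morph F : x y / add x y >-> add' x y} ->
  map (map F) (phase_rows T o add a b c d e f g h i j k) =
  phase_rows U o' add' (F a) (F b) (F c) (F d) (F e) (F f) (F g) (F h)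
    (F i) (F j) (F k).
Proof. by move=> Fo FD; rewrite /phase_rows /= !FD Fo. Qed.

Lemma nth_map_default (T U : Type) (F : T -> U) x0 s i :
  nth (F x0) (map F s) i = F (nth x0 s i).
Proof. by elim: s i => [|x s IH] [|i] /=. Qed.

(** Vectors hold the coefficients of the parameters [a] to [k]. Missing coefficients default to 0,
    so [[::]] is the zero form; results always have length 11, so that equal forms produced by
    [vec_sub] are equal lists. *)
Definition vec_add (u v : seq int) : seq int :=
  mkseq (fun i => u`_i + v`_i) 11.
Definition vec_sub (u v : seq int) : seq int :=
  mkseq (fun i => u`_i - v`_i) 11.
Definition unit_vec (i : nat) : seq int := mkseq (fun j => Posz (j == i)) 11.

Definition form (s t : nat) : seq int :=
  nth [::] (nth [::] (phase_rows _ [::] vec_add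
    (unit_vec 0) (unit_vec 1) (unit_vec 2) (unit_vec 3) (unit_vec 4)
    (unit_vec 5) (unit_vec 6) (unit_vec 7) (unit_vec 8) (unit_vec 9)
    (unit_vec 10)) s) t.

Section LinearForm.
Variables (R : realType) (p : seq R).

Definition eval_form (u : seq int) : R := \sum_(i < 11) p`_i *~ u`_i.

Lemma eval_form0 : eval_form [::] = 0.
Proof. by rewrite /eval_form big1 // => i _; rewrite nth_nil mulr0z. Qed.

Lemma eval_formD : {morph eval_form : u v / vec_add u v >-> u + v}.
Proof.
move=> u v; rewrite /eval_form -big_split; apply: eq_bigr => i _.
by rewrite nth_mkseq // mulrzDr.
Qed.

Lemma eval_formB : {morph eval_form : u v / vec_sub u v >-> u - v}.
Proof.
move=> u v; rewrite /eval_form -sumrB; apply: eq_bigr => i _.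
by rewrite nth_mkseq // mulrzBr.
Qed.

Lemma eval_unit_vec i : (i < 11)%N -> eval_form (unit_vec i) = p`_i.
Proof.
move=> i11; rewrite /eval_form (bigD1 (Ordinal i11)) //= big1 => [|j ji].
  by rewrite nth_mkseq // eqxx addr0.
by rewrite nth_mkseq // (_ : (j == i :> nat) = false) //; exact: negbTE.
Qed.

End LinearForm.

(** Evaluation at the parameters is additive, so it carries the symbolic table to the real one. *)
Lemma R16E (R : realType) (a b c d e f g h i j k : R) s t :
  R16 a b c d e f g h i j k s t =
  eval_form R [:: a; b; c; d; e; f; g; h; i; j; k] (form s t).
Proof.
set p := [:: a; b; c; d; e; f; g; h; i; j; k].
rewrite /form -nth_map_default eval_form0.
rewrite -(nth_map_default _ _ (map (eval_form R p))).
rewrite (map_phase_rows _ _ _ _ _ _ _ _ _ _ _ _ _ _ _ _ _ _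
  (eval_form0 R p) (eval_formD R p)).
by rewrite !eval_unit_vec // /R16 mxE.
Qed.

Lemma S16E (R : realType) s t : S16 R s t = omega R ^+ exponent s t.
Proof. by rewrite mxE cexp_eighth E16E. Qed.

(* The pair (m, u) stands for omega ^+ m * expi (eval_form p u); a row product
   lists the summands of a Hermitian product, complex conjugation being
   multiplication by 7 on exponents of omega. *)
Definition row_product (s s' : nat) : seq (nat * seq int) :=
  [seq (((exponent s t + 7 * exponent s' t) %% 8)%N,
        vec_sub (form s t) (form s' t)) | t <- iota 0 16].

Definition antipode (x : nat * seq int) : nat * seq int :=
  (((x.1 + 4) %% 8)%N, x.2).

Definition antipodal (l : seq (nat * seq int)) := perm_eq l (map antipode l).

Lemma row_product_antipodal (s s' : 'I_16) :
  s != s' -> antipodal (row_product s s').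
Proof.
(* All pairs of rows are checked by computation on formal monomials, hence for all parameter values
   at once. *)
have : all (fun s => all (fun s' => (s == s') || antipodal (row_product s s'))
  (iota 0 16)) (iota 0 16) by vm_compute.
move=> /allP/(_ s); rewrite mem_iota ltn_ord => /(_ isT).
move=> /allP/(_ s'); rewrite mem_iota ltn_ord => /(_ isT).
by case/orP=> // /eqP/val_inj ->; rewrite eqxx.
Qed.

(** * Orthogonality of the rows *)

Section Family.
Variables (R : realType) (p : seq R).

Definition monomial_value (x : nat * seq int) : R[i] :=
  omega R ^+ x.1 * expi R (eval_form R p x.2).

Lemma monomial_value_antipode m u :
  monomial_value (antipode ((m %% 8)%N, u)) = - monomial_value ((m %% 8)%N, u).
Proof. by rewrite /monomial_value /= omega_antipode modn_mod mulNr. Qed.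

(** Passing to antipodes permutes the summands and negates each, so the sum equals its own
    negative. *)
Lemma antipodal_sum0 s s' : antipodal (row_product s s') ->
  \sum_(x <- row_product s s') monomial_value x = 0.
Proof.
move=> anti.
have E : \sum_(x <- row_product s s') monomial_value x =
         - \sum_(x <- row_product s s') monomial_value x.
  rewrite [LHS](perm_big (map antipode (row_product s s'))) // big_map.
  rewrite -sumrN /row_product !big_map.
  by apply: eq_bigr => t _; rewrite monomial_value_antipode.
by move/eqP: E; rewrite -addr_eq0 -mulr2n mulrn_eq0 => /eqP.
Qed.
End Family.

Lemma dotmx_rowE (C : numClosedFieldType) (m n : nat) (A : 'M[C]_(m, n)) s s' :
  dotmx (row s A) (row s' A) = \sum_t A s t * (A s' t)^*%R.
Proof. by rewrite dotmxE mxE; apply: eq_bigr => t _; rewrite !mxE. Qed.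

Section Hadamard.
Variables (R : realType) (a b c d e f g h i j k : R).
Let p := [:: a; b; c; d; e; f; g; h; i; j; k].
Let K := S16_11 a b c d e f g h i j k.

Lemma S16_11E s t : K s t = monomial_value R p (exponent s t, form s t).
Proof. by rewrite mxE S16E cexp_imaginary R16E. Qed.

Lemma S16_11_norm s t : `|K s t| = 1.
Proof. by rewrite S16_11E normrM normrX !norm_expi expr1n mul1r. Qed.

Lemma S16_11_col0 s : K s ord0 = 1.
Proof.
have : all (fun s => (exponent s 0 == 0%N) && (form s 0 == [::])) (iota 0 16).
  by vm_compute.
move=> /allP/(_ s); rewrite mem_iota ltn_ord => /(_ isT)/andP[/eqP e0 /eqP f0].
by rewrite S16_11E /= e0 f0 /monomial_value eval_form0 expi0 mulr1.
Qed.

Lemma S16_11_hadamard : complex_hadamard K.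
Proof.
split=> [s t|s s' ss']; first exact: S16_11_norm.
(* The right-hand 0 becomes the symbolic row product; the two sums then agree term by term. *)
rewrite -(antipodal_sum0 R p s s' (row_product_antipodal s s' ss')).
rewrite big_map -[iota 0 16]/(index_iota 0 16) big_mkord dotmx_rowE.
apply: eq_bigr => t _; rewrite !S16_11E /monomial_value /=.
rewrite rmorphM /= conj_omegaX (conj_norm1 _ _ (norm_expi _ _)).
rewrite -expiN eval_formB.
by rewrite (prim_expr_mod (omega_prim R)) exprD expiD mulrACA.
Qed.

End Hadamard.

(** * Level sets of the columns and the obstruction to Dita type *)

Definition level_size (t v : nat) : nat :=
  count (fun s => exponent s t == v) (iota 0 16).

Lemma card_level (t v : nat) :
  #|[set s : 'I_16 | exponent s t == v]| = level_size t v.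
Proof.
rewrite cardsE cardE /enum_mem size_filter -enumT /level_size.
by rewrite -val_enum_ord count_map; apply: eq_count.
Qed.

Lemma odd_level (t : 'I_16) : t != 0 :> nat -> t != 4 :> nat ->
  exists v, odd (level_size t v).
Proof.
move=> t0 t4.
have : all (fun t => [|| t == 0, t == 4 |
    has (fun v => odd (level_size t v)) (iota 0 8)])%N (iota 0 16).
  by vm_compute.
move=> /allP/(_ t); rewrite mem_iota ltn_ord (negbTE t0) (negbTE t4).
by move=> /(_ isT)/hasP[v _ ?]; exists v.
Qed.

Lemma exponent_lt8 (s t : 'I_16) : (exponent s t < 8)%N.
Proof.
have : all (fun s => all (fun t => exponent s t < 8)%N (iota 0 16)) (iota 0 16).
  by vm_compute.
move=> /allP/(_ s); rewrite mem_iota ltn_ord => /(_ isT).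
by move=> /allP/(_ t); rewrite mem_iota ltn_ord => /(_ isT).
Qed.

Lemma S16_inj (R : realType) (s s' t : 'I_16) :
  S16 R s t = S16 R s' t -> exponent s t = exponent s' t.
Proof.
move=> /eqP; rewrite !S16E (eq_prim_root_expr (omega_prim R)).
by rewrite /= !modn_small ?exponent_lt8 // => /eqP.
Qed.

Lemma not_dita_near_S16 (R : realType) (K : 'M[R[i]]_16) :
  (forall s, K s ord0 = 1) ->
  (forall s s' t, S16 R s t != S16 R s' t -> K s t != K s' t) ->
  ~ dita_type K.
Proof.
move=> K0 sepK /dita_typeE[k [n [f [g [M [B [d [e]]]]]]]].
move=> [kn [k2 n2] f_inj g_inj KE].
pose J := [set t | (g t).1 == (g ord0).1].
have cardJ : #|J| = n by exact: card_fiber_fst.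
have dvd_level (t : 'I_16) v : t \in J -> (k %| level_size t v)%N.
  rewrite inE => /eqP tJ; rewrite -card_level.
  apply: (dvdn_card_saturated _ _ (fun s => (f s).2)) => [i|s s' ss'].
    exact: card_fiber_snd.
  rewrite !inE => /eqP <-; apply/eqP/esym/(S16_inj R)/eqP.
  apply: contraT => /sepK/eqP[].
  (* Since column 0 is constantly 1, this relation makes column [t] constant on each row class. *)
  have : K s t * K s' ord0 = K s ord0 * K s' t by rewrite !KE tJ ss'; ring.
  by rewrite !K0 mulr1 mul1r.
have k_even : (2 %| k)%N.
  (* [k] is a divisor of 16 that is at least 2. *)
  have := dvdn_mulr n (dvdnn k); rewrite kn.
  have: (k <= 16)%N by rewrite -kn leq_pmulr // ltnW.
  move: k k2 {kn M f g f_inj g_inj KE cardJ J dvd_level B}.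
  by do 17?[case=> //].
have J_sub (t : 'I_16) : t \in J -> t != 0 :> nat -> t = 4 :> nat.
  move=> tJ t0; apply/eqP/negPn/negP => t4.
  have [v] := odd_level t t0 t4.
  by rewrite -[odd _]negbK -dvdn2 (dvdn_trans k_even) // dvd_level.
have J0 : ord0 \in J by rewrite inE.
pose o4 : 'I_16 := inord 4.
have J04 : J \subset [set ord0; o4].
  apply/fintype.subsetP => t tJ; rewrite !inE; case: (eqVneq t ord0) => //= t0.
  by apply/eqP/val_inj; rewrite /= inordK // J_sub.
have n_eq2 : n = 2%N.
  apply/eqP; rewrite eqn_leq n2 andbT -cardJ.
  by apply: leq_trans (subset_leq_card J04) _; rewrite cards2; case: (_ != _).
have o4J : o4 \in J.
  have -> : J = [set ord0; o4].
    apply/eqP; rewrite eqEcard J04 cardJ n_eq2.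
    by rewrite cards2; case: (_ != _).
  by rewrite !inE eqxx orbT.
(* The value 2 occurs in column 4 only in rows 1 and 4, while [k] is 8. *)
have := dvd_level o4 2%N o4J; rewrite inordK //.
move: kn; rewrite n_eq2.
move: k {k2 M f g f_inj g_inj KE cardJ J dvd_level B k_even J_sub J0 J04 o4J}.
by do 9?[case=> //].
Qed.

Local Open Scope classical_set_scope.

(** Finitely many conditions are imposed, each the non-vanishing of a continuous difference of two
    entries. *)
Lemma near_separated (C : numFieldType) (m n : nat) (A : 'M[C]_(m, n)) :
  nbhs A [set K : 'M[C]_(m, n) |
    forall s s' t, A s t != A s' t -> K s t != K s' t].
Proof.
pose sep (x : 'I_m * 'I_m * 'I_n) : set 'M[C]_(m, n) :=
  [set K | A x.1.1 x.2 != A x.1.2 x.2 -> K x.1.1 x.2 != K x.1.2 x.2].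
suff near_sep x : nbhs A (sep x).
  have := filter_forall (nbhs_filter A) near_sep.
  by apply: filterS => K sepK s s' t; exact: (sepK (s, s', t)).
case: x => -[s s'] t.
rewrite /sep /=; have [AA|AA] := eqVneq (A s t) (A s' t).
  by apply: filterE => K /=.
have : (fun K : 'M[C]_(m, n) => K s t - K s' t) @ A --> A s t - A s' t.
  apply: cvgB; first exact: nbhs_filter.
    exact: coord_continuous.
  exact: coord_continuous.
move=> /cvgr_neq0; rewrite subr_eq0 => /(_ AA).
by apply: filterS => K; rewrite subr_eq0.
Qed.

Local Open Scope complex_scope.
Local Open Scope ring_scope.

(* [R[i]^o] is R[i] with the topology of its modulus. *)
Theorem mainTheorem5 (R : realType) :
  (forall a b c d e f g h i j k : R,
     complex_hadamard (S16_11 a b c d e f g h i j k)) /\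
  (exists U : set 'M[R[i]^o]_16,
     nbhs (S16 R : 'M[R[i]^o]_16) U /\
     forall a b c d e f g h i j k : R,
       U (S16_11 a b c d e f g h i j k) ->
       ~ dita_type (S16_11 a b c d e f g h i j k)).
Proof.
split=> [a b c d e f g h i j k|]; first exact: S16_11_hadamard.
exists [set K | forall s s' t, S16 R s t != S16 R s' t -> K s t != K s' t].
split=> [|a b c d e f g h i j k]; first exact: (near_separated R[i]).
by apply: not_dita_near_S16 => s; exact: S16_11_col0.
Qed.
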